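(* Let $\mathscr T=(V,E)$ be a rootless and leafless directed tree. Let $S_{\boldsymbol\lambda}\in\boldsymbol B(\ell^2(V))$ be a weighted shift on $\mathscr T$ with nonzero weights $\boldsymbol\lambda=\{\lambda_v\}_{v\in V}$. If $S_{\boldsymbol\lambda}$ is centered, then the following conditions are equivalent: (i) $S_{\boldsymbol\lambda}$ is type I centered; (ii) $\bigcap_{n=1}^\infty\overline{\mathcal R(S_{\boldsymbol\lambda}^n)}=\{0\}$. Moreover, if $S_{\boldsymbol\lambda}$ is type I centered, then the following condition holds: (iii) $\mathscr T$ is not isomorphic to $\mathbb Z$ (equivalently, $\mathscr T$ has at least one branching vertex).
   Context: A directed tree $\mathscr T=(V,E)$ is a directed graph that is connected (as an undirected graph), has no directed circuits, and in which every vertex has at most one parent. $\mathsf{Chi}(u)=\{v\in V:(u,v)\in E\}$ is the set of children of $u$; $\mathsf{par}(u)$ is the parent of $u$ (the unique $v$ with $(v,u)\in E$). Rootless means every vertex has a parent; leafless means $\mathsf{Chi}(u)\neq\varnothing$ for all $u$. A branching vertex is a vertex with at least two children. $\mathbb Z$ is regarded as the directed tree with edges $(k,k+1)$, $k\in\mathbb Z$. For a rootless tree and weights $\boldsymbol\lambda=\{\lambda_v\}_{v\in V}\subseteq\mathbb C$ with $\sup_{v\in V}\sum_{u\in\mathsf{Chi}(v)}|\lambda_u|^2<\infty$, the weighted shift $S_{\boldsymbol\lambda}$ on $\mathscr T$ is the bounded operator on $\ell^2(V)$ given by $(S_{\boldsymbol\lambda}f)(v)=\lambda_vf(\mathsf{par}(v))$,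 $v\in V$. $\boldsymbol B(\mathcal H)$ denotes the bounded operators on $\mathcal H$; $\mathcal R(A)$ is the range of $A$. A bounded operator $T$ on a complex Hilbert space $\mathcal H$ is centered if all the operators $T^{n}T^{*n}$, $T^{*n}T^{n}$, $n\geqslant1$, commute with each other. Let $T=U|T|$ be the polar decomposition ($U$ a partial isometry with $\ker U=\ker T$). A centered $T$ is type I centered if $U$ is a pure isometry (an isometry without nonzero unitary part); equivalently, $\bigcap_{n=1}^\infty\overline{\mathcal R(T^n)}=\{0\}$ and $\bigcap_{n=1}^\infty\overline{\mathcal R(|T^n|)}=\mathcal H$. *)

(* Defs.v *)
From HB Require Import structures.
From mathcomp Require Import all_boot all_order all_algebra.
From mathcomp Require Import boolp classical_sets functions cardinality fsbigop.
From mathcomp Require Import constructive_ereal reals ereal topology normedtype numfun esum.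
From mathcomp Require Import complex finmap.
From mathcomp Require Import ring lra.
Set Implicit Arguments. Unset Strict Implicit. Unset Printing Implicit Defensive.
Import Order.TTheory GRing.Theory Num.Theory.
Local Open Scope classical_set_scope.
Local Open Scope ring_scope.
Local Open Scope complex_scope.
Import numFieldNormedType.Exports.
Import Normc.

(* The inner product is linear in its first argument. *)
HB.mixin Record NormedModule_isInner (R : realType) H & NormedModule R[i] H := {
  inner : H -> H -> R[i];
  innerDl : forall x y z, inner (x + y) z = inner x z + inner y z;
  innerZl : forall (a : R[i]) x y, inner (a *: x) y = a * inner x y;
  innerC : forall x y, inner y x = (inner x y)^*;
  inner_norm : forall x, inner x x = `|x| ^+ 2
}.

#[short(type="hilbertType")]
HB.structure Definition Hilbert (R : realType) :=
  {H of CompleteNormedModule R[i] H & NormedModule_isInner R H}.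

Section operators.
Context {R : realType} {H : hilbertType R}.
Implicit Types (T U P A B : H -> H) (M : set H).

Definition bounded_op T : Prop := linear T /\ continuous T.

(* For bounded T the set below is a singleton (Riesz); for other functions
   the value is irrelevant. *)
Definition adjoint T : H -> H :=
  fun y => xget 0 [set z | forall x, inner (T x) y = inner x z].

(* The family {T^n T*^n, T*^n T^n : n >= 1}. *)
Definition power_products T : set (H -> H) :=
  [set A | exists2 n, (1 <= n)%N &
     A = iter n T \o iter n (adjoint T) \/ A = iter n (adjoint T) \o iter n T].

Definition centered T : Prop :=
  forall A B, power_products T A -> power_products T B -> A \o B =1 B \o A.

(* [0 <= z] in R[i] means that z is real and nonnegative. *)
Definition positive_op P : Prop := forall x, 0 <= inner (P x) x.

(* P = |T|, the positive square root of T* T. *)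
Definition is_modulus T P : Prop :=
  [/\ bounded_op P, positive_op P & P \o P =1 adjoint T \o T].

(* U is isometric on the orthogonal complement of its kernel. *)
Definition partial_isometry U : Prop :=
  forall x, (forall z, U z = 0 -> inner x z = 0) -> `|U x| = `|x|.

Definition polar_decomposition T U P : Prop :=
  [/\ bounded_op U, partial_isometry U, is_modulus T P,
      T =1 U \o P & forall x, U x = 0 <-> T x = 0].

Definition isometry_op U : Prop := linear U /\ forall x, `|U x| = `|x|.

Definition closed_subspace M : Prop :=
  [/\ M 0, forall (a : R[i]) x y, M x -> M y -> M (a *: x + y) & closed M].

Definition reducing U M : Prop :=
  (forall x, M x -> M (U x)) /\ (forall x, M x -> M (adjoint U x)).

Definition unitary_on U M : Prop :=
  (forall x, M x -> `|U x| = `|x|) /\ U @` M = M.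

Definition pure_isometry U : Prop :=
  isometry_op U /\
  forall M, closed_subspace M -> reducing U M -> unitary_on U M -> M = [set 0].

(* The polar decomposition exists and is unique for bounded T. *)
Definition type_I_centered T : Prop :=
  centered T /\ exists U P, polar_decomposition T U P /\ pure_isometry U.

End operators.

Section sums.
Context {R : realType} {V : choiceType}.
Implicit Types F G : V -> R.

(* Unconditional sum: positive part minus negative part; only meaningful for
   absolutely summable F. *)
Definition rsum F : R :=
  fine (\esum_(v in [set: V]) (EFin \o F)^\+ v -
        \esum_(v in [set: V]) (EFin \o F)^\- v)%E.

Definition rsummable F := summable [set: V] (EFin \o F).

Lemma rsummable_ge0 F : (forall v, 0 <= F v) ->
  rsummable F = (\esum_(v in [set: V]) (F v)%:E < +oo)%E.
Proof.
move=> F0; rewrite /rsummable /summable; congr (_ < _)%E.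
by apply: eq_esum => v _ /=; rewrite ger0_norm.
Qed.

Lemma rsummable_le F G : (forall v, `|F v| <= G v) -> rsummable G -> rsummable F.
Proof.
move=> FG; apply: le_lt_trans; apply: le_esum => v _ /=.
by rewrite lee_fin (le_trans (FG v))// ler_norm.
Qed.

Lemma rsummableD F G : rsummable F -> rsummable G -> rsummable (F \+ G).
Proof. by move=> sF sG; have := summableD sF sG. Qed.

Lemma esumZ (c : R) F : 0 <= c -> (forall v, 0 <= F v) ->
  \esum_(v in [set: V]) (c * F v)%:E = (c%:E * \esum_(v in [set: V]) (F v)%:E)%E.
Proof.
have le (d : R) G : 0 <= d -> (forall v, 0 <= G v) ->
  (\esum_(v in [set: V]) (d * G v)%:E <= d%:E * \esum_(v in [set: V]) (G v)%:E)%E.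
  move=> d0 G0; apply: ge_ereal_sup => _ [X [finX _]] <-.
  under eq_fsbigr do rewrite EFinM.
  rewrite -ge0_mule_fsumr; last by move=> v; rewrite lee_fin.
  apply: lee_wpmul2l; first by rewrite lee_fin.
  by apply: ereal_sup_ubound; exists X.
rewrite le_eqVlt => /predU1P[<- F0|c0 F0].
  by rewrite mul0e; apply: esum1 => v _; rewrite mul0r.
apply/eqP; rewrite eq_le le ?(ltW c0)//=.
rewrite -lee_pdivlMl//.
apply: le_trans (le c^-1 (fun v => c * F v) _ _).
- by apply: le_esum => v _; rewrite mulKf// gt_eqF.
- by rewrite invr_ge0 ltW.
- by move=> v; rewrite mulr_ge0// ltW.
Qed.

Lemma rsummableZ (c : R) F : rsummable F -> rsummable (fun v => c * F v).
Proof.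
move=> sF; rewrite /rsummable /summable.
rewrite (eq_esum (b := fun v => (`|c| * `|F v|)%:E)); last first.
  by move=> v _; rewrite /= normrM.
by rewrite esumZ// lte_mul_pinfty// ?lee_fin.
Qed.

Lemma esum_fin F : rsummable F -> (forall v, 0 <= F v) ->
  (\esum_(v in [set: V]) (F v)%:E)%E \is a fin_num.
Proof.
move=> sF F0; rewrite ge0_fin_numE; last by apply: esum_ge0 => v _; rewrite lee_fin.
by rewrite -rsummable_ge0.
Qed.

Lemma rsumB F G : rsummable F -> rsummable G ->
  (forall v, 0 <= F v) -> (forall v, 0 <= G v) ->
  rsum (F \- G) = fine (\esum_(v in [set: V]) (F v)%:E)
                - fine (\esum_(v in [set: V]) (G v)%:E).
Proof.
move=> sF sG F0 G0.
have := @esumB R V [set: V] (EFin \o F) (EFin \o G) sF sG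
  (fun v _ => F0 v) (fun v _ => G0 v).
rewrite /rsum => ->; rewrite fineB//; exact: esum_fin.
Qed.

Lemma rsum_ge0 F : rsummable F -> (forall v, 0 <= F v) ->
  rsum F = fine (\esum_(v in [set: V]) (F v)%:E).
Proof.
move=> sF F0; have -> : F = F \- (fun=> 0) by apply/funext => v /=; rewrite subr0.
rewrite rsumB//; last first.
  by apply: (rsummable_le _ sF) => v; rewrite normr0.
rewrite [X in _ - fine X]esum1// subr0; congr fine.
by apply: eq_esum => v _ /=; rewrite subr0.
Qed.

Let pos F := fun v => Num.max (F v) 0.
Let neg F := fun v => Num.max (- F v) 0.
Let pos0 F v : 0 <= pos F v. Proof. by rewrite le_max lexx orbT. Qed.
Let neg0 F v : 0 <= neg F v. Proof. by rewrite le_max lexx orbT. Qed.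
Let posneg F : F = pos F \- neg F.
Proof.
apply/funext => v /=; rewrite /pos /neg; have [h|/ltW h] := leP (F v) 0.
  by rewrite max_l ?oppr_ge0// sub0r opprK.
by rewrite max_r ?oppr_le0// subr0.
Qed.
Let spos F : rsummable F -> rsummable (pos F).
Proof.
move=> sF; apply: (@rsummable_le _ (fun v => `|F v|)).
  by move=> v; rewrite ger0_norm// ge_max normr_ge0 ler_norm.
by apply: le_lt_trans sF; apply: le_esum => v _ /=; rewrite normr_id.
Qed.
Let sneg F : rsummable F -> rsummable (neg F).
Proof.
move=> sF; apply: (@rsummable_le _ (fun v => `|F v|)).
  by move=> v; rewrite ger0_norm// ge_max normr_ge0 -normrN ler_norm.
by apply: le_lt_trans sF; apply: le_esum => v _ /=; rewrite normr_id.
Qed.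

Let fine_esumD F G : rsummable F -> rsummable G ->
  (forall v, 0 <= F v) -> (forall v, 0 <= G v) ->
  fine (\esum_(v in [set: V]) (F v + G v)%:E) =
  fine (\esum_(v in [set: V]) (F v)%:E) + fine (\esum_(v in [set: V]) (G v)%:E).
Proof.
move=> sF sG F0 G0; under eq_esum do rewrite EFinD.
rewrite esumD; [|by move=> v _; rewrite lee_fin..].
by rewrite fineD//; exact: esum_fin.
Qed.

Let rsumE F : rsummable F ->
  rsum F = fine (\esum_(v in [set: V]) (pos F v)%:E)
         - fine (\esum_(v in [set: V]) (neg F v)%:E).
Proof.
move=> sF; have [pF nF] := conj (spos sF) (sneg sF).
by rewrite -rsumB// -posneg.
Qed.

Lemma rsumD F G : rsummable F -> rsummable G -> rsum (F \+ G) = rsum F + rsum G.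
Proof.
move=> sF sG.
have -> : F \+ G = (pos F \+ pos G) \- (neg F \+ neg G).
  by rewrite [in LHS](posneg F) [in LHS](posneg G); apply/funext => v /=; ring.
have [pF pG nF nG] := And4 (spos sF) (spos sG) (sneg sF) (sneg sG).
rewrite rsumB; do ?[exact: rsummableD|by move=> v; rewrite addr_ge0].
have := fine_esumD pF pG (@pos0 F) (@pos0 G).
have := fine_esumD nF nG (@neg0 F) (@neg0 G).
move=> /= -> ->; rewrite (rsumE sF) (rsumE sG); ring.
Qed.

Lemma rsumN F : rsummable F -> rsum (fun v => - F v) = - rsum F.
Proof.
move=> sF; have [pF nF] := conj (spos sF) (sneg sF).
have -> : (fun v => - F v) = neg F \- pos F.
  by rewrite [in LHS](posneg F); apply/funext => v /=; ring.
by rewrite rsumB// (rsumE sF) opprB.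
Qed.

Lemma rsumZ (c : R) F : rsummable F -> rsum (fun v => c * F v) = c * rsum F.
Proof.
have ge0 (d : R) G : 0 <= d -> rsummable G -> rsum (fun v => d * G v) = d * rsum G.
  move=> d0 sG; have [pG nG] := conj (spos sG) (sneg sG).
  have -> : (fun v => d * G v) = (fun v => d * pos G v) \- (fun v => d * neg G v).
    by rewrite [in LHS](posneg G); apply/funext => v /=; ring.
  rewrite rsumB; do ?[exact: rsummableZ|by move=> v; rewrite mulr_ge0].
  rewrite !esumZ// !fineM//; [|exact: esum_fin..].
  by rewrite (rsumE sG) mulrBr.
move=> sF; have [c0|c0] := leP 0 c; first exact: ge0.
have -> : (fun v => c * F v) = (fun v => - (- c * F v)).
  by apply/funext => v; ring.
rewrite rsumN; last exact: rsummableZ.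
by rewrite ge0//; [ring|lra].
Qed.

Lemma rsum_le F G : rsummable F -> rsummable G -> (forall v, 0 <= F v) ->
  (forall v, F v <= G v) -> rsum F <= rsum G.
Proof.
move=> sF sG F0 FG; have G0 v : 0 <= G v by exact: le_trans (FG v).
rewrite !rsum_ge0// fine_le ?esum_fin//.
by apply: le_esum => v _; rewrite lee_fin.
Qed.

Lemma rsum_bounded F (M : R) : (forall v, 0 <= F v) ->
  (forall X : {fset V}, \sum_(v <- X) F v <= M) -> rsummable F /\ rsum F <= M.
Proof.
move=> F0 FM.
have le : (\esum_(v in [set: V]) (F v)%:E <= M%:E)%E.
  apply: ge_ereal_sup => _ [X [finX _]] <-.
  by rewrite fsbig_finite//= sumEFin lee_fin.
have sF : rsummable F by rewrite rsummable_ge0// (le_lt_trans le)// ltry.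
by split => //; rewrite rsum_ge0// -lee_fin fineK// esum_fin.
Qed.

Lemma rsum_fset_le F (X : {fset V}) : rsummable F -> (forall v, 0 <= F v) ->
  \sum_(v <- X) F v <= rsum F.
Proof.
move=> sF F0; rewrite rsum_ge0// -lee_fin fineK ?esum_fin// -sumEFin.
apply: esum_ge; exists [set` X]; first by split => //; exact: finite_fset.
by rewrite fsbig_finite//= set_fsetK.
Qed.
Lemma rsum_ge_term F v : rsummable F -> (forall v, 0 <= F v) -> F v <= rsum F.
Proof.
by move=> sF F0; have := rsum_fset_le [fset v]%fset sF F0; rewrite big_seq_fset1.
Qed.
End sums.

Fact sqrD2_le (R : realType) (a b c d : R) :
  (a + c) ^+ 2 + (b + d) ^+ 2 <= 2 * (a ^+ 2 + b ^+ 2) + 2 * (c ^+ 2 + d ^+ 2).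
Proof. by have := sqr_ge0 (a - c); have := sqr_ge0 (b - d); lra. Qed.

Fact mul2_le (R : realType) (a b c d : R) :
  `|a * c + b * d| <= (a ^+ 2 + b ^+ 2) + (c ^+ 2 + d ^+ 2).
Proof.
have := sqr_ge0 (a - c); have := sqr_ge0 (b - d).
have := sqr_ge0 (a + c); have := sqr_ge0 (b + d).
have := sqr_ge0 a; have := sqr_ge0 b; have := sqr_ge0 c; have := sqr_ge0 d.
by rewrite ler_norml => *; apply/andP; split; lra.
Qed.

Section l2_fun.
Context {R : realType} {V : choiceType}.
Implicit Types (f g h : V -> R[i]) (z w : R[i]).

Definition square_summable f : Prop :=
  (\esum_(v in [set: V]) (normc (f v) ^+ 2)%:E < +oo)%E.

Let addfE f g v : (f + g) v = f v + g v. Proof. by []. Qed.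
Let scalefE z f v : (z *: f) v = z * f v. Proof. by []. Qed.
Let zerofE v : (0 : V -> R[i]) v = 0. Proof. by []. Qed.
Let fctE := (addfE, scalefE, zerofE).

Lemma normc2 z : normc z ^+ 2 = complex.Re z ^+ 2 + complex.Im z ^+ 2.
Proof. by case: z => a b /=; rewrite sqr_sqrtr// addr_ge0// sqr_ge0. Qed.

Lemma square_summableE f :
  square_summable f <-> rsummable (fun v => normc (f v) ^+ 2).
Proof. by rewrite rsummable_ge0// => v; exact: sqr_ge0. Qed.

Lemma ssqr f : square_summable f -> rsummable (fun v => normc (f v) ^+ 2).
Proof. by move=> /square_summableE. Qed.

Lemma square_summable0 : square_summable 0.
Proof.
rewrite /square_summable esum1// => v _.
by rewrite fctE normc0 expr0n.
Qed.

Lemma square_summableD f g :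
  square_summable f -> square_summable g -> square_summable (f + g).
Proof.
rewrite !square_summableE => sf sg.
have := rsummableD (rsummableZ 2 sf) (rsummableZ 2 sg).
apply: rsummable_le => v; rewrite ger0_norm ?sqr_ge0//= !normc2 !fctE.
case: (f v) (g v) => [a b] [c d]; exact: sqrD2_le.
Qed.

Lemma square_summableZ z f : square_summable f -> square_summable (z *: f).
Proof.
rewrite !square_summableE => /(rsummableZ (normc z ^+ 2)).
apply: rsummable_le => v; rewrite ger0_norm ?sqr_ge0//.
by rewrite fctE normcM exprMn.
Qed.

Let cjRe f g v := complex.Re (f v * (g v)^*).
Let cjIm f g v := complex.Im (f v * (g v)^*).

Lemma rsummable_dot f g : square_summable f -> square_summable g ->
  rsummable (cjRe f g) /\ rsummable (cjIm f g).
Proof.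
rewrite !square_summableE => sf sg.
have s := rsummableD sf sg; split; apply: rsummable_le s => v;
  rewrite /cjRe /cjIm /= !normc2; case: (f v) (g v) => [a b] [c d] /=.
  by rewrite mulrN opprK; exact: mul2_le.
by rewrite -(sqrrN d) [X in _ <= _ + X]addrC; exact: mul2_le.
Qed.

Definition dot f g : R[i] :=
  rsum (fun v => complex.Re (f v * (g v)^*)) +i* rsum (fun v => complex.Im (f v * (g v)^*)).

Lemma dotDl f g h : square_summable f -> square_summable g -> square_summable h ->
  dot (f + g) h = dot f h + dot g h.
Proof.
move=> sf sg sh.
have [a1 a2] := rsummable_dot sf sh; have [b1 b2] := rsummable_dot sg sh.
apply/eqP; rewrite eq_complex/= -!rsumD//; apply/andP; split; apply/eqP;
  by congr rsum; apply/funext => v /=; rewrite /cjRe /cjIm fctE mulrDl raddfD.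
Qed.

Lemma dotZl z f g : square_summable f -> square_summable g ->
  dot (z *: f) g = z * dot f g.
Proof.
move=> sf sg; have [a1 a2] := rsummable_dot sf sg; case: z => p q.
apply/eqP; rewrite eq_complex/= -mulNr -!rsumZ// -!rsumD; try exact: rsummableZ.
by apply/andP; split; apply/eqP; congr rsum; apply/funext => v /=;
  rewrite /cjRe /cjIm fctE; case: (f v) (g v) => [a b] [c d] /=; ring.
Qed.

Lemma dotC f g : square_summable f -> square_summable g -> dot g f = (dot f g)^*.
Proof.
move=> sf sg; have [a1 a2] := rsummable_dot sf sg.
apply/eqP; rewrite eq_complex/= -rsumN//; apply/andP; split; apply/eqP;
  by congr rsum; apply/funext => v; rewrite /cjRe /cjIm;
  case: (f v) (g v) => [a b] [c d] /=; ring.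
Qed.

Definition nrm2 f : R := fine (\esum_(v in [set: V]) (normc (f v) ^+ 2)%:E).

Lemma nrm2E f : square_summable f -> nrm2 f = rsum (fun v => normc (f v) ^+ 2).
Proof.
by rewrite square_summableE => sf; rewrite rsum_ge0// => v; exact: sqr_ge0.
Qed.

Lemma dotff f : square_summable f -> dot f f = (nrm2 f)%:C.
Proof.
move=> sf; apply/eqP; rewrite eq_complex/= nrm2E//; apply/andP; split; apply/eqP.
  congr rsum; apply/funext => v; rewrite normc2.
  by case: (f v) => a b /=; ring.
rewrite rsum_ge0; last first.
- by move=> v; case: (f v) => a b /=; lra.
- by have [] := rsummable_dot sf sf.
by rewrite esum1// => v _; case: (f v) => a b /=; congr EFin; ring.
Qed.

Lemma nrm2_ge0 f : 0 <= nrm2 f.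
Proof. by apply/fine_ge0/esum_ge0 => v _; rewrite lee_fin sqr_ge0. Qed.

Lemma nrm2D f g : square_summable f -> square_summable g ->
  nrm2 (f + g) = nrm2 f + 2 * complex.Re (dot f g) + nrm2 g.
Proof.
move=> sf sg; have sfg := square_summableD sf sg.
have [a1 a2] := rsummable_dot sf sg.
have nf : rsummable (fun v => normc (f v) ^+ 2) by exact: ssqr.
have ng : rsummable (fun v => normc (g v) ^+ 2) by exact: ssqr.
have a3 := rsummableZ 2 a1.
rewrite !nrm2E// /dot/= -(rsumZ 2 a1) -(rsumD nf a3).
rewrite -(rsumD (rsummableD nf a3) ng).
congr rsum; apply/funext => v /=; rewrite !normc2 fctE.
by rewrite /cjRe; case: (f v) (g v) => [a b] [c d] /=; ring.
Qed.

Lemma nrm2Z z f : square_summable f -> nrm2 (z *: f) = normc z ^+ 2 * nrm2 f.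
Proof.
move=> sf; rewrite !nrm2E//; last exact: square_summableZ.
rewrite -rsumZ; last exact: ssqr.
by congr rsum; apply/funext => v; rewrite fctE normcM exprMn.
Qed.

Lemma normc_le_nrm2 f v : square_summable f -> normc (f v) ^+ 2 <= nrm2 f.
Proof.
move=> sf; rewrite nrm2E//.
apply: (@rsum_ge_term _ _ (fun v => normc (f v) ^+ 2)); first exact: ssqr.
by move=> u; exact: sqr_ge0.
Qed.

Lemma nrm2_eq0 f : square_summable f -> nrm2 f = 0 -> f = 0.
Proof.
move=> sf f0; apply/funext => v; apply: eq0_normc; apply/eqP.
by rewrite -sqrf_eq0 eq_le sqr_ge0 -[leRHS]f0 normc_le_nrm2.
Qed.

Lemma re_dot_le f g : square_summable f -> square_summable g ->
  complex.Re (dot f g) <= Num.sqrt (nrm2 f) * Num.sqrt (nrm2 g).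
Proof.
move=> sf sg; set b := Num.sqrt (nrm2 g); set a := Num.sqrt (nrm2 f).
have a2 : a ^+ 2 = nrm2 f by rewrite sqr_sqrtr// nrm2_ge0.
have b2 : b ^+ 2 = nrm2 g by rewrite sqr_sqrtr// nrm2_ge0.
have a0 : 0 <= a := sqrtr_ge0 _.
have : 0 <= b := sqrtr_ge0 _; rewrite le_eqVlt => /predU1P[b0|b0].
  have -> : g = 0 by apply: nrm2_eq0 => //; rewrite -b2 -b0 expr0n.
  rewrite -b0 mulr0 (_ : dot f 0 = 0)//.
  have s0 := square_summable0.
  rewrite dotC// (_ : dot 0 f = 0) ?conjc0//.
  by rewrite -(scale0r f) dotZl// mul0r.
pose t := - (a / b).
have := nrm2_ge0 (f + t%:C *: g).
have sg' := square_summableZ t%:C sg.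
have -> : nrm2 (f + t%:C *: g) = a ^+ 2 + 2 * (t * complex.Re (dot f g)) + t ^+ 2 * b ^+ 2.
  rewrite nrm2D// nrm2Z// (dotC sg' sf) dotZl// (dotC sf sg) normc2 -a2 -b2.
  by case: (dot f g) => p q /=; ring.
have -> : t ^+ 2 * b ^+ 2 = a ^+ 2 by rewrite /t; field; rewrite gt_eqF.
rewrite /t mulNr => h.
have [a00|an0] := eqVneq a 0.
  have f0 : f = 0 by apply: nrm2_eq0 => //; rewrite -a2 a00 expr0n.
  by rewrite a00 mul0r f0 -(scale0r f) dotZl// mul0r.
have ap : 0 < a by rewrite lt_def an0.
have : a / b * complex.Re (dot f g) <= a ^+ 2 by lra.
rewrite mulrAC ler_pdivrMr// expr2 -!mulrA ler_pM2l//.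
Qed.

Definition nrm f : R := Num.sqrt (nrm2 f).

Lemma nrm_ge0 f : 0 <= nrm f. Proof. exact: sqrtr_ge0. Qed.

Lemma sqr_nrm f : nrm f ^+ 2 = nrm2 f.
Proof. by rewrite sqr_sqrtr// nrm2_ge0. Qed.

Lemma nrmD f g : square_summable f -> square_summable g ->
  nrm (f + g) <= nrm f + nrm g.
Proof.
move=> sf sg; rewrite -ler_sqr ?nnegrE ?addr_ge0 ?nrm_ge0//.
rewrite sqrrD !sqr_nrm nrm2D//; have := re_dot_le sf sg.
by rewrite -/(nrm f) -/(nrm g); lra.
Qed.

Lemma nrmZ z f : square_summable f -> nrm (z *: f) = normc z * nrm f.
Proof.
move=> sf; rewrite /nrm nrm2Z// sqrtrM ?sqr_ge0// sqrtr_sqr ger0_norm//.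
by case: z => ? ?; exact: sqrtr_ge0.
Qed.
End l2_fun.

Section l2_type.
Variables (R : realType) (V : choiceType).

Definition l2_pred : {pred V -> R[i]} := fun f => `[< square_summable f >].

Record l2 := L2 { l2_fun :> V -> R[i]; l2_funP : l2_fun \in l2_pred }.

HB.instance Definition _ := [isSub for l2_fun].
HB.instance Definition _ := [Choice of l2 by <:].

Fact l2_submod_closed : submod_closed l2_pred.
Proof.
split => [|z f g]; first by apply/asboolP/square_summable0.
move=> /asboolP sf /asboolP sg; apply/asboolP.
by apply: square_summableD => //; exact: square_summableZ.
Qed.
HB.instance Definition _ := GRing.isSubmodClosed.Build R[i] (V -> R[i]) l2_pred
  l2_submod_closed.
HB.instance Definition _ := [SubChoice_isSubLmodule of l2 by <:].

Implicit Types f g : l2.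

Lemma l2P f : square_summable f. Proof. exact/asboolP/l2_funP. Qed.

Lemma l2_val f : val f = f :> (V -> R[i]). Proof. by []. Qed.

Definition l2_norm f : R[i] := (nrm f)%:C.

Fact l2_normD f g : l2_norm (f + g) <= l2_norm f + l2_norm g.
Proof. by rewrite -rmorphD lecR nrmD//; exact: l2P. Qed.

Fact l2_normZ (z : R[i]) f : l2_norm (z *: f) = `|z| * l2_norm f.
Proof.
rewrite /l2_norm nrmZ; last exact: l2P.
by rewrite rmorphM.
Qed.

Fact l2_norm_eq0 f : l2_norm f = 0 -> f = 0.
Proof.
move=> /complexI f0; apply: val_inj; apply: nrm2_eq0; first exact: l2P.
by rewrite -sqr_nrm f0 expr0n.
Qed.

HB.instance Definition _ :=
  Lmodule_isNormed.Build R[i] l2 l2_normD l2_normZ l2_norm_eq0.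

Lemma l2_normE f : `|f| = (nrm f)%:C. Proof. by []. Qed.
End l2_type.

Section l2_hilbert.
Variables (R : realType) (V : choiceType).
Local Notation l2 := (l2 R V).
Implicit Types f g : l2.

Let normc_ge_Re (z : R[i]) : `|complex.Re z| <= normc z.
Proof. by have := normc_ge_Re z; rewrite lecR. Qed.

Let normc_ge_Im (z : R[i]) : `|complex.Im z| <= normc z.
Proof.
rewrite -ler_sqr ?nnegrE//; last by case: z => ? ?; exact: sqrtr_ge0.
by rewrite real_normK ?num_real// normc2 lerDr sqr_ge0.
Qed.

Let normc_le_nrm f v : normc (f v) <= nrm f.
Proof.
rewrite -ler_sqr ?nnegrE ?nrm_ge0//; last by case: (f v) => ? ?; exact: sqrtr_ge0.
by rewrite sqr_nrm normc_le_nrm2//; exact: l2P.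
Qed.

Fact l2_complete (F : set_system l2) : ProperFilter F -> cauchy F -> cvg F.
Proof.
move=> FF /cauchy_ballP cF.
have small (e : R) : 0 < e ->
    exists2 A, F A & forall f g, A f -> A g -> nrm (f - g) < e.
  move=> e0; have /cF [[A B]/= [FA FB] AB] : 0 < e%:C :> R[i] by rewrite ltcR.
  exists (A `&` B); first exact: filterI.
  move=> f g [Af _] [_ Bg]; have := AB (f, g) (conj Af Bg).
  by rewrite /= -ball_normE/= l2_normE ltcR.
have cvg_coord (p : R[i] -> R) (v : V) : {morph p : x y / x - y} ->
    (forall z, `|p z| <= normc z) -> cvg ((fun f : l2 => p (f v)) @ F).
  move=> pB ple; apply: cauchy_cvg; apply: cauchy_exP => e e0.
  have [A FA Ae] := small e e0; have [f Af] := filter_ex FA.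
  exists (p (f v)).
  suff : F ((fun g : l2 => p (g v)) @^-1` ball (p (f v)) e) by [].
  apply: filterS FA => g Ag /=.
  rewrite -ball_normE; change (`|p (f v) - p (g v)| < e).
  rewrite -pB (le_lt_trans (ple _))//.
  by apply: le_lt_trans (Ae _ _ Af Ag); exact: (normc_le_nrm (f - g)).
have ReB : {morph @complex.Re R : x y / x - y} by move=> [? ?] [? ?].
have ImB : {morph @complex.Im R : x y / x - y} by move=> [? ?] [? ?].
have cvgRe v := cvg_coord _ v ReB normc_ge_Re.
have cvgIm v := cvg_coord _ v ImB normc_ge_Im.
pose l (v : V) : R[i] := lim ((fun f : l2 => complex.Re (f v)) @ F)
                       +i* lim ((fun f : l2 => complex.Im (f v)) @ F).
have cvg_fset f (X : seq V) :
    (fun g : l2 => \sum_(v <- X) normc ((f - g) v) ^+ 2) @ F -->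
    \sum_(v <- X) normc (f v - l v) ^+ 2.
  elim: X => [|v X IH].
    under eq_fun do rewrite big_nil.
    by rewrite big_nil; exact: cvg_cst.
  under eq_fun do rewrite big_cons.
  rewrite big_cons; apply: cvgD => //.
  under eq_fun => g.
    rewrite normc2 (_ : complex.Re _ = complex.Re (f v) - complex.Re (g v)); last exact: ReB.
    rewrite (_ : complex.Im _ = complex.Im (f v) - complex.Im (g v)); last exact: ImB.
    rewrite !expr2; over.
  rewrite normc2 ReB ImB !expr2.
  have hRe : (fun g : l2 => complex.Re (f v) - complex.Re (g v)) @ F -->
    complex.Re (f v) - complex.Re (l v) by apply: cvgB (cvg_cst _) (cvgRe v).
  have hIm : (fun g : l2 => complex.Im (f v) - complex.Im (g v)) @ F -->
    complex.Im (f v) - complex.Im (l v) by apply: cvgB (cvg_cst _) (cvgIm v).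
  exact: cvgD (cvgM hRe hRe) (cvgM hIm hIm).
have tail (e : R) : 0 < e -> exists2 A, F A & forall f, A f ->
    square_summable (fun v => f v - l v) /\ nrm2 (fun v => f v - l v) <= e ^+ 2.
  move=> e0; have [A FA Ae] := small e e0; exists A => // f Af.
  have bnd (X : {fset V}) : \sum_(v <- X) normc (f v - l v) ^+ 2 <= e ^+ 2.
    apply: cvgr_to_le (cvg_fset f X) _; apply: filterS FA => g Ag.
    have sfg := l2P (f - g).
    apply: le_trans (_ : nrm2 (f - g) <= _).
      rewrite nrm2E//; apply: (@rsum_fset_le _ _ (fun v => normc ((f - g) v) ^+ 2)).
        exact: ssqr.
      by move=> v; exact: sqr_ge0.
    by rewrite -sqr_nrm ler_sqr ?nnegrE ?nrm_ge0 ?ltW//; exact: Ae.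
  have [s le] := rsum_bounded (fun v => sqr_ge0 (normc (f v - l v))) bnd.
  have ss : square_summable (fun v => f v - l v) by exact/square_summableE.
  by rewrite nrm2E.
have sl : square_summable l.
  have [A FA /= Al] := tail 1 ltr01; have [f Af] := filter_ex FA.
  have [sfl _] := Al f Af.
  rewrite (_ : l = (f : V -> R[i]) + (-1) *: (fun v => f v - l v)); last first.
    apply/funext => v; change (l v = f v + (-1) * (f v - l v)).
    by rewrite mulN1r opprB addrC subrK.
  by apply: square_summableD; [exact: l2P|exact: square_summableZ].
have lP : l \in @l2_pred R V by exact/asboolP.
apply/cvg_ex; exists (L2 lP); apply/cvg_ballP => e; rewrite ltcE/= => /andP[/eqP ie re].
have [A FA Al] := tail (complex.Re e / 2) (divr_gt0 re (ltr0Sn _ 1)); rewrite near_map/=.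
apply: filterS FA => f /Al[sfl fl].
rewrite -ball_normE/= distrC l2_normE ltcE/= ie eqxx/=.
apply: (@le_lt_trans _ _ (complex.Re e / 2)); last by rewrite ltr_pdivrMr// ltr_pMr// ltr1n.
by rewrite -ler_sqr ?nnegrE ?nrm_ge0 ?divr_ge0 ?(ltW re)// sqr_nrm.
Qed.

HB.instance Definition _ := Uniform_isComplete.Build l2 l2_complete.

Definition l2_inner f g : R[i] := dot f g.

Fact l2_innerDl f g h : l2_inner (f + g) h = l2_inner f h + l2_inner g h.
Proof. by apply: dotDl; exact: l2P. Qed.

Fact l2_innerZl (z : R[i]) f g : l2_inner (z *: f) g = z * l2_inner f g.
Proof. by apply: dotZl; exact: l2P. Qed.

Fact l2_innerC f g : l2_inner g f = (l2_inner f g)^*.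
Proof. by apply: dotC; exact: l2P. Qed.

Fact l2_inner_norm f : l2_inner f f = `|f| ^+ 2.
Proof. by rewrite /l2_inner dotff ?l2_normE -?rmorphXn/= ?sqr_nrm//; exact: l2P. Qed.

HB.instance Definition _ :=
  NormedModule_isInner.Build R l2 l2_innerDl l2_innerZl l2_innerC l2_inner_norm.

End l2_hilbert.


Section tree.
Variables (V : choiceType).
Implicit Types (E : rel V) (u v : V).

(* Acyclicity is required of cycles of every length, which excludes loops. *)
Record is_directed_tree E : Prop := {
  dtree_inhabited : inhabited V ;
  dtree_connected : forall u v,
    exists2 p : seq V, path [rel x y | E x y || E y x] u p & last u p = v ;
  dtree_acyclic : forall c : seq V, cycle E c -> c = [::] ;
  dtree_parent_uniq : forall u u' v, E u v -> E u' v -> u = u' }.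

Definition rootless E := forall v, exists u, E u v.
Definition children E u : set V := [set v | E u v].
Definition leafless E := forall u, children E u !=set0.
(* Only meaningful when v has a parent; always the case in a rootless tree. *)
Definition parent E v : V := xget v [set u | E u v].
Definition branching E u := exists v w, [/\ children E u v, children E u w & v <> w].
End tree.

Definition digraph_iso (V W : Type) (E : rel V) (F : rel W) : Prop :=
  exists h : V -> W, bijective h /\ forall u v, F (h u) (h v) = E u v.

Definition int_tree : rel int := [rel k l | l == k + 1].

Section wshift.
Context {R : realType} {V : choiceType}.
Variables (E : rel V) (lam : V -> R[i]).

Definition weight_bounded : Prop :=
  (ereal_sup (range (fun v => \esum_(u in children E v) (normc (lam u) ^+ 2)%:E)) < +oo)%E.

(* The default value 0 is never used when the weights are bounded: see wshiftE. *)
Definition wshift : l2 R V -> l2 R V :=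
  fun f => insubd (0 : l2 R V) (fun v => lam v * f (parent E v)).

Hypothesis (tE : is_directed_tree E) (rE : rootless E) (bE : weight_bounded).

Lemma parentP v : E (parent E v) v.
Proof. by have [u Euv] := rE v; exact: (xgetI (P := [set u | E u v]) _ Euv). Qed.

Lemma parent_eq u v : E u v -> parent E v = u.
Proof. exact: dtree_parent_uniq tE _ _ _ (parentP v). Qed.

Lemma weight_boundedP : exists2 M : R, 0 <= M &
  forall v, (\esum_(u in children E v) (normc (lam u) ^+ 2)%:E <= M%:E)%E.
Proof.
have [x0] := dtree_inhabited tE.
move: bE; rewrite /weight_bounded; set s := ereal_sup _ => soo; have s0 : (0 <= s)%E.
  apply: le_trans (ereal_sup_ubound _); last by exists x0.
  by apply: esum_ge0 => v _; rewrite lee_fin sqr_ge0.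
have sfin : s \is a fin_num by rewrite ge0_fin_numE.
exists (fine s); first exact: fine_ge0.
by move=> v; rewrite fineK//; apply: ereal_sup_ubound; exists v.
Qed.

Lemma esum_tree (a : V -> \bar R) : (forall v, 0 <= a v)%E ->
  \esum_(v in [set: V]) a v = \esum_(u in [set: V]) \esum_(v in children E u) a v.
Proof.
move=> a0; rewrite (esum_esum (a := fun _ v => a v))//.
apply: reindex_esum; split => //.
- move=> [u v] [u' v'] /set_mem[_ /= Euv] /set_mem[_ /= Euv'] /= vv'.
  by move: Euv'; rewrite -vv' => /(dtree_parent_uniq tE Euv) ->.
- by move=> v _; exists (parent E v, v) => //; split => //; exact: parentP.
Qed.

Lemma wshift_bound : exists2 M : R, 0 <= M & forall f : V -> R[i],
  (\esum_(v in [set: V]) (normc (lam v * f (parent E v)) ^+ 2)%:E <=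
   M%:E * \esum_(v in [set: V]) (normc (f v) ^+ 2)%:E)%E.
Proof.
have [M M0 bM] := weight_boundedP; exists M => // f.
rewrite esum_tree; last by move=> v; rewrite lee_fin sqr_ge0.
rewrite -esumZ//; last by move=> v; exact: sqr_ge0.
apply: le_esum => u _.
have c0 : 0 <= normc (f u) ^+ 2 := sqr_ge0 _.
rewrite (eq_esum (b := fun v => (normc (f u) ^+ 2 * (if v \in children E u then normc (lam v) ^+ 2 else 0))%:E)); last first.
  move=> v Euv; rewrite mem_set// (parent_eq Euv) normcM exprMn mulrC//.
rewrite esum_mkcond.
rewrite (eq_esum (b := fun v => (normc (f u) ^+ 2 * (if v \in children E u then normc (lam v) ^+ 2 else 0))%:E)); last first.
  by move=> v _; case: (v \in _); rewrite // mulr0.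
rewrite esumZ//; last by move=> v; case: ifP => // _; exact: sqr_ge0.
rewrite [M * _]mulrC [leRHS]EFinM; apply: lee_wpmul2l; first by rewrite lee_fin.
apply: le_trans (bM u); rewrite [leRHS]esum_mkcond.
by apply: le_esum => v _; case: ifP.
Qed.

Lemma wshift_summable (f : l2 R V) :
  square_summable (fun v => lam v * f (parent E v)).
Proof.
have [M M0 /(_ f) le] := wshift_bound; apply: le_lt_trans le _.
by apply: lte_mul_pinfty; rewrite ?lee_fin//; exact: l2P.
Qed.

Lemma wshiftE (f : l2 R V) v : wshift f v = lam v * f (parent E v).
Proof.
by rewrite /wshift -l2_val insubdK//; apply/asboolP; exact: wshift_summable.
Qed.

Lemma wshift_linear : linear wshift.
Proof.
move=> z f g; apply: val_inj; apply/funext => v; rewrite l2_val wshiftE.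
change (lam v * (z * f (parent E v) + g (parent E v)) = z * wshift f v + wshift g v).
by rewrite !wshiftE; ring.
Qed.

Lemma wshift_continuous : continuous wshift.
Proof.
have [M M0 bM] := wshift_bound.
pose S : {linear l2 R V -> l2 R V} := HB.pack wshift
  (GRing.isLinear.Build _ _ _ _ wshift wshift_linear).
apply: (@bounded_linear_continuous _ _ _ S).
apply/linear_boundedP; exists (Num.sqrt M)%:C; split.
  by rewrite ger0_real// ler0c sqrtr_ge0.
move=> r; rewrite ltcE/= => /andP[/eqP ir Mr] f.
have -> : r = (complex.Re r)%:C by case: r ir {Mr} => p q /= ->.
rewrite !l2_normE -rmorphM lecR.
apply: le_trans (ler_wpM2r (nrm_ge0 f) (ltW Mr)).
rewrite -ler_sqr ?nnegrE ?mulr_ge0 ?sqrtr_ge0 ?nrm_ge0//.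
rewrite exprMn (sqr_sqrtr M0) (sqr_nrm f) (sqr_nrm (wshift f)) /nrm2.
rewrite -lee_fin EFinM !fineK; last 2 first.
- by apply: (esum_fin (F := fun v => normc (f v) ^+ 2)) => [|v]; [exact/ssqr/l2P|exact: sqr_ge0].
- by apply: (esum_fin (F := fun v => normc (wshift f v) ^+ 2)) => [|v]; [exact/ssqr/l2P|exact: sqr_ge0].
by apply: le_trans (bM f); apply: le_esum => v _; rewrite wshiftE.
Qed.

Lemma wshift_bounded_op : bounded_op wshift.
Proof. exact: conj wshift_linear wshift_continuous. Qed.

End wshift.

(* Main.v *)
Require Import Defs.
From mathcomp Require Import all_boot all_order all_algebra.
From mathcomp Require Import boolp classical_sets cardinality fsbigop.
From mathcomp Require Import constructive_ereal reals ereal topology normedtype esum.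
From mathcomp Require Import complex finmap.
From mathcomp Require Import ring lra zify.
Import Order.TTheory GRing.Theory Num.Theory.
Import numFieldNormedType.Exports Normc.
Set Implicit Arguments. Unset Strict Implicit. Unset Printing Implicit Defensive.
Local Open Scope classical_set_scope.
Local Open Scope ring_scope.
Local Open Scope complex_scope.

(** Write [S] for the weighted shift, [d u] for the l2 norm of the weights on
the children of [u], and [D] for multiplication by [d]. Every [d u] is positive
because the tree is leafless and the weights do not vanish, and [S = U D],
where [U] is the weighted shift with weights [lam v / d (parent v)]. The
weights of [U] have l2 norm 1 on each set of siblings, so [U] is an isometry,
and [S = U D] is the polar decomposition of [S] ([wshift_polar],
[polar_uniq]). Hence type I means that [U] is pure.

By the Wold decomposition, an isometry is pure exactly when its iterates have
ranges with trivial intersection ([pure_isometryP]). What remains is to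
compare the ranges of the iterates of [S] and of [U], and this is where
centeredness enters. The vector [S^n delta_u] lives on the n-th generation of
descendants of [u] and is an eigenvector of [S^n S*^n] for a nonzero
eigenvalue. As [S* S = D^2] commutes with [S^n S*^n], the vector
[D^2 S^n delta_u] lies in the range of [S^n], and comparing values shows that
[d] is constant on that generation ([diag_generation]). So [S^n delta_u] and
[U^n delta_u] are proportional with a nonzero factor; as point masses span a
dense subspace and isometries have closed range, the closure of the range of
[S^n] is the range of [U^n] ([closure_range_wshift]). Both conditions
therefore say that [U] is pure ([type_I_rangeP]).

If no vertex branches, then [S] maps each [delta_u] to a nonzero multiple of
[delta_v], for [v] the only child of [u]. All the point masses then lie in the
range of every [S^n], which contradicts the range condition
([type_I_not_iso_int]). Finally, in a rootless and leafless tree without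
branching, going to the child and going to the parent are inverse to each
other, and they enumerate the vertices along the integers starting from any
vertex: connectedness makes the enumeration surjective and acyclicity makes it
injective ([no_branching_iso_int]). *)

(** * Isometries of a Hilbert space *)

Section hilbert.
Context {R : realType} {H : hilbertType R}.
Implicit Types (T U S : H -> H) (M : set H) (x y z : H).

Lemma innerDr x y z : inner x (y + z) = inner x y + inner x z.
Proof. by rewrite innerC innerDl rmorphD /= -!innerC. Qed.

Lemma innerZr (a : R[i]) x y : inner x (a *: y) = a^* * inner x y.
Proof. by rewrite innerC innerZl rmorphM /= -innerC. Qed.

Lemma inner_inj y z : (forall x, inner x y = inner x z) -> y = z.
Proof.
move=> yz; apply/eqP; rewrite -subr_eq0 -normr_eq0 -sqrf_eq0 -inner_norm.
by rewrite innerDr -[- z]scaleN1r innerZr yz rmorphN1 mulN1r subrr.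
Qed.

(** The adjoint is a chosen witness of this relation, and nondegeneracy of the
inner product leaves at most one witness. *)
Lemma adjointE T y z : (forall x, inner (T x) y = inner x z) -> adjoint T y = z.
Proof.
move=> Tyz; have := xgetI 0 (Tyz : [set z | forall x, inner (T x) y = inner x z] z).
by rewrite -/(adjoint T y) => h; apply: inner_inj => x; rewrite -h Tyz.
Qed.

Lemma linear_id : linear (@id H). Proof. by []. Qed.

Lemma linear_iter T n : linear T -> linear (iter n T).
Proof. by move=> lT; elim: n => // n IH a x y; rewrite !iterS IH lT. Qed.

Lemma continuous_iter T n : continuous T -> continuous (iter n T).
Proof.
move=> cT; elim: n => [|n IH] x; first exact: cvg_id.
by apply: (@continuous_comp _ _ _ (iter n T) T); [exact: IH|exact: cT].
Qed.

Lemma continuous_norm_eq T S : linear T -> linear S -> continuous S ->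
  (forall x, `|T x| = `|S x|) -> continuous T.
Proof.
move=> lT lS cS TS x; apply/cvgrPdist_lt => e e0.
have /cvgrPdist_lt/(_ e e0) := cS x; apply: filterS => z.
by rewrite -!(zmod_morphism_linear lS, zmod_morphism_linear lT) TS.
Qed.

Lemma isometry_continuous U : isometry_op U -> continuous U.
Proof.
move=> [lU nU]; apply: (continuous_norm_eq lU linear_id) => [x|//].
exact: cvg_id.
Qed.

(** Polarization: the squared norm of [x + y] determines
[inner x y + inner y x], and replacing [y] by ['i *: y] separates the two terms. *)
Lemma isometry_inner U : isometry_op U -> forall x y, inner (U x) (U y) = inner x y.
Proof.
move=> [lU nU].
have pol x y : inner (U x) (U y) + inner (U y) (U x) = inner x y + inner y x.
  have : inner (U (x + y)) (U (x + y)) = inner (x + y) (x + y).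
    by rewrite !inner_norm nU.
  have -> : U (x + y) = U x + U y by rewrite -[x in LHS]scale1r lU scale1r.
  rewrite !innerDl !innerDr !inner_norm !nU => h.
  by apply: (addrI (`|x| ^+ 2)); apply: (addIr (`|y| ^+ 2)); move: h; rewrite !addrA.
move=> x y; have := pol x y; have := pol x ('i *: y).
rewrite (scalable_linear lU) /= !innerZr !innerZl conjCi.
set a := inner (U x) _; set b := inner (U y) _; set c := inner x y; set d := inner y x.
move=> h1 h2; have i0 := neq0Ci R[i].
have : 'i * (b - a) = 'i * (d - c).
  by rewrite !mulrBr addrC -mulNr h1 mulNr addrC.
move/(mulfI i0) => h3.
have : a *+ 2 = c *+ 2.
  by rewrite !mulr2n; transitivity (a + b - (b - a)); [ring|rewrite h2 h3; ring].
by move=> /eqP; rewrite -subr_eq0 -mulrnBl mulrn_eq0/= subr_eq0 => /eqP.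
Qed.

Lemma isometry_adjointK U : isometry_op U -> forall x, adjoint U (U x) = x.
Proof. by move=> iU x; apply: adjointE => z; exact: isometry_inner. Qed.

Lemma isometry_inj U : isometry_op U -> injective U.
Proof. by move=> iU x y Uxy; rewrite -(isometry_adjointK iU x) Uxy isometry_adjointK. Qed.

Lemma isometry_iter U n : isometry_op U -> isometry_op (iter n U).
Proof.
move=> [lU nU]; split; first exact: linear_iter.
by elim: n => //= n IH x; rewrite nU.
Qed.

(** The neighbourhoods of a point of the closure pull back along [U] to a
Cauchy filter, and the image of its limit is that point. *)
Lemma isometry_range_closed U : isometry_op U -> closed (range U).
Proof.
move=> iU y cly.
have [lU nU] := iU.
pose F := filter_from (nbhs y) (fun B => U @^-1` B).
have FF : ProperFilter F.
  apply: filter_from_proper.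
    apply: filter_from_filter; first by exists setT; exact: filterT.
    by move=> A B yA yB; exists (A `&` B); [exact: filterI|].
  by move=> B /cly[_ [[x _ <-] Bx]]; exists x.
have cF : cauchy F.
  apply: cauchy_exP => e e0.
  have [_ [[x _ <-] yx]] := cly _ (nbhsx_ballx y _ (divr_gt0 e0 (ltr0n _ 2))).
  exists x, (ball y (e / 2)); first exact/nbhsx_ballx/divr_gt0.
  move=> z yz; rewrite -ball_normE/= -nU (zmod_morphism_linear lU).
  have : ball (U x) e (U z) by exact: ball_splitr yx yz.
  by rewrite -ball_normE.
exists (lim F) => //.
have Fl : F --> lim F by exact: cauchy_cvg.
have h1 : (U @ F) --> U (lim F).
  by apply: cvg_trans (@isometry_continuous U iU (lim F)); exact: cvg_app Fl.
have h2 : (U @ F) --> y by move=> B yB; exists B.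
exact: cvg_unique h1 h2.
Qed.

Lemma range_iter_sub U m n : (m <= n)%N -> range (iter n U) `<=` range (iter m U).
Proof.
by move=> /subnKC <- _ [x _ <-]; rewrite iterD; exists (iter (n - m) U x).
Qed.

Lemma range_linear_submod T (a : R[i]) x y : linear T ->
  range T x -> range T y -> range T (a *: x + y).
Proof. by move=> lT [u _ <-] [v _ <-]; exists (a *: u + v) => //; rewrite lT. Qed.

Lemma linear0_eq T : linear T -> T 0 = 0.
Proof. by move=> lT; have := scalable_linear lT 0 0; rewrite /= !scale0r. Qed.

Lemma isometry_range_subspace U : isometry_op U -> closed_subspace (range U).
Proof.
move=> iU; have lU := iU.1; split.
- by exists 0 => //; exact: linear0_eq.
- by move=> a x y; exact: range_linear_submod.
- exact: isometry_range_closed.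
Qed.

(** The intersection of the ranges is the unitary part of [U] in the Wold
decomposition: it reduces [U], and [U] maps it onto itself, while any subspace
that [U] maps onto itself lies in all the ranges. *)
Lemma pure_isometryP U : isometry_op U ->
  pure_isometry U <-> \bigcap_(n in [set n | (1 <= n)%N]) range (iter n U) = [set 0].
Proof.
move=> iU; have [lU nU] := iU.
have range0 n : range (iter n U) 0.
  by exists 0 => //; apply: linear0_eq; exact: linear_iter.
split=> [[_ pU]|capU].
  set W := \bigcap_(n in _) _.
  have WU x : W x -> exists2 y, W y & U y = x.
    move=> Wx; have [y _ yx] := Wx 1%N isT; exists y => // n n0.
    have [z _ zx] := Wx n.+1 isT; exists z => //.
    by apply: (isometry_inj iU); rewrite -iterS zx -yx.
  have UW x : W x -> W (U x).
    move=> Wx [//|n] _; have [z _ zx] := Wx n.+1 isT.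
    by apply: (range_iter_sub (leqnSn n.+1)); exists z => //; rewrite iterS zx.
  apply: pU; last 1 first.
  - split; first by move=> x _; exact: nU.
    rewrite eqEsubset; split; first by move=> _ [x Wx <-]; exact: UW.
    by move=> x /WU[y Wy <-]; exists y.
  - split; first by move=> n _; exact: range0.
      move=> a x y Wx Wy n n1; apply: range_linear_submod; first exact: linear_iter.
        exact: Wx.
      exact: Wy.
    by apply: closed_bigI => n _; apply/isometry_range_closed/isometry_iter.
  - split; first exact: UW.
    by move=> x /WU[y Wy <-]; rewrite isometry_adjointK.
split=> // M [M0 _ _] _ [_ UM]; rewrite eqEsubset; split; last by move=> _ ->.
move=> x Mx; rewrite -capU => n _.
elim: n x Mx => [|n IH] x; first by exists x.
by rewrite -{1}UM => -[y /IH[z _ <-] <-]; exists z.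
Qed.

Lemma preimage_subspace T M : bounded_op T -> closed_subspace M ->
  closed_subspace (T @^-1` M).
Proof.
move=> [lT cT] [M0 MD cM]; split.
- by rewrite /preimage/= linear0_eq.
- by move=> a x y Mx My; rewrite /preimage/= lT; exact: MD.
- by have /continuous_closedP/(_ M cM) := cT.
Qed.

(** Addition and scaling are continuous, so they preserve the closure. *)
Lemma closure_range_subspace T : linear T -> closed_subspace (closure (range T)).
Proof.
move=> lT; split; last exact: closed_closure.
- by apply: subset_closure; exists 0 => //; exact: linear0_eq.
- move=> a x y clx cly B nB.
  have : (fun p : H * H => a *: p.1 + p.2) @ nbhs (x, y) --> a *: x + y.
    by apply: cvgD; [apply: cvgZr; exact: cvg_fst|exact: cvg_snd].
  move=> /(_ B nB)[[X Y]/= [nX nY] XYB].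
  have [x' [Tx' Xx']] := clx X nX; have [y' [Ty' Yy']] := cly Y nY.
  exists (a *: x' + y'); split; first exact: range_linear_submod.
  exact: (XYB (x', y')).
Qed.

Lemma bounded_op_iter T n : bounded_op T -> bounded_op (iter n T).
Proof. by move=> [lT cT]; split; [exact: linear_iter|exact: continuous_iter]. Qed.

Lemma isometry_bounded_op U : isometry_op U -> bounded_op U.
Proof. by move=> iU; split; [exact: iU.1|exact: isometry_continuous]. Qed.
End hilbert.

(** * Density of the finitely supported functions *)

Section point_masses.
Context {R : realType} {V : choiceType}.
Implicit Types (f g : l2 R V) (u v w : V).

Fact delta_subproof u : (fun v => (v == u)%:R) \in @l2_pred R V.
Proof.
apply/asboolP; apply: (@le_lt_trans _ _ (1%:E)%E); last exact: ltry.
rewrite (eq_esum (b := fun v => if v \in [set u] then 1%:E else 0%E)).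
  by rewrite -esum_mkcond esum_set1.
move=> v _; case: ifPn => [/set_mem ->|vu]; first by rewrite eqxx normc1 expr1n.
have /negbTE -> : v != u by apply: contraNneq vu => ->; exact: mem_set.
by rewrite normc0 expr0n.
Qed.

Definition delta u : l2 R V := L2 (delta_subproof u).

Lemma deltaE u v : delta u v = (v == u)%:R. Proof. by []. Qed.

Lemma l2_addE f g v : (f + g) v = f v + g v. Proof. by []. Qed.
Lemma l2_scaleE (c : R[i]) f v : (c *: f) v = c * f v. Proof. by []. Qed.

Lemma l2_ext f g : (forall v, f v = g v) -> f = g.
Proof. by move=> fg; apply: val_inj; apply/funext. Qed.

Lemma delta_neq0 u : delta u != 0.
Proof.
by apply/eqP => /(congr1 (fun f : l2 R V => f u))/eqP; rewrite deltaE eqxx oner_eq0.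
Qed.

Lemma inner_termwise f g f' g' : (forall v, f v * (g v)^* = f' v * (g' v)^*) ->
  inner f g = inner f' g'.
Proof.
by move=> e; congr (_ +i* _); congr rsum; apply/funext => v; rewrite e.
Qed.

Lemma l2_truncate (M : set (l2 R V)) f (X : seq V) : closed_subspace M ->
  (forall u, M (delta u)) ->
  exists2 g, M g & forall v, g v = if v \in X then f v else 0.
Proof.
move=> [M0 MD _] Md; elim: X => [|x X [g Mg gE]]; first by exists 0.
have [xX|xX] := boolP (x \in X).
  exists g => // v; rewrite gE in_cons; case: eqVneq => //= -> .
  by rewrite xX.
exists (f x *: delta x + g); first exact: MD.
move=> v; rewrite l2_addE l2_scaleE deltaE gE in_cons; case: eqVneq => [->|vx] /=.
  by rewrite (negbTE xX) mulr1 addr0.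
by rewrite mulr0 add0r.
Qed.

(** The squared norm is a supremum of finite sums. *)
Lemma nrm2_tail f (e : R) : 0 < e ->
  exists X : {fset V}, nrm2 f - \sum_(v <- X) normc (f v) ^+ 2 < e.
Proof.
move=> e0.
have F0 v : 0 <= normc (f v) ^+ 2 by exact: sqr_ge0.
have ffin := esum_fin (ssqr (l2P f)) F0.
have [_ [A [finA _] <-]] := ub_ereal_sup_adherent e0 ffin.
rewrite fsbig_finite//= sumEFin -/(esum _ _) => h.
exists (fset_set A); rewrite ltrBlDr -ltrBlDl -lte_fin EFinB fineK//.
Qed.

(** Finitely supported functions are combinations of point masses, and the
truncation of [f] to a large finite set is close to [f] because the two parts
of [f] have disjoint supports. *)
Lemma l2_dense (M : set (l2 R V)) : closed_subspace M ->
  (forall u, M (delta u)) -> forall f, M f.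
Proof.
move=> cM Md f; have [_ _] := cM; apply => B /nbhs_ballP[e /= e0 eB].
have [re ie] : 0 < complex.Re e /\ e = (complex.Re e)%:C.
  by move: e0; rewrite ltcE/= => /andP[/eqP ie re]; case: e ie re {eB} => p q /= ->.
have [X Xe] := nrm2_tail f (exprn_gt0 2 re).
have [g Mg gE] := l2_truncate f X cM Md.
exists g; split => //; apply: eB; rewrite -ball_normE/= ie l2_normE ltcR.
rewrite -ltr_sqr ?nnegrE ?nrm_ge0 ?(ltW re)// sqr_nrm; apply: le_lt_trans Xe.
have sg := ssqr (l2P g); have sf := ssqr (l2P f); have sd := ssqr (l2P (f - g)).
have split_f : nrm2 f = nrm2 g + nrm2 (f - g).
  rewrite !nrm2E; do ?[exact: l2P]; rewrite -rsumD//; congr rsum.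
  apply/funext => v.
  change (normc (f v) ^+ 2 = normc (g v) ^+ 2 + normc (f v - g v) ^+ 2); rewrite gE.
  by case: ifP => _; rewrite ?subrr ?subr0 normc0 expr0n ?addr0 ?add0r.
have : \sum_(v <- X) normc (f v) ^+ 2 <= nrm2 g.
  rewrite nrm2E; last exact: l2P.
  apply: le_trans (rsum_fset_le X sg _); last by move=> v; exact: sqr_ge0.
  by rewrite !big_seq; apply: ler_sum => v vX; rewrite gE vX.
by rewrite split_f; lra.
Qed.
End point_masses.

(** * Weighted shifts and generations *)

Section children_sums.
Context {R : realType} {V : choiceType}.
Variables (E : rel V).
Hypotheses (tE : is_directed_tree E) (rE : rootless E).
Implicit Types (lam : V -> R[i]).

Lemma esumZ_in (A : set V) (c : R) (F : V -> R) : 0 <= c -> (forall v, 0 <= F v) ->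
  (\esum_(v in A) (c * F v)%:E = c%:E * \esum_(v in A) (F v)%:E)%E.
Proof.
move=> c0 F0; rewrite esum_mkcond [in RHS]esum_mkcond.
transitivity (\esum_(v in [set: V]) (c * (if v \in A then F v else 0))%:E)%E.
  by apply: eq_esum => v _; case: ifP => _; rewrite ?mulr0.
rewrite esumZ//; last by move=> v; case: ifP.
by congr (_ * _)%E; apply: eq_esum => v _; case: ifP.
Qed.

Definition child_mass lam u : R :=
  fine (\esum_(v in children E u) (normc (lam v) ^+ 2)%:E).

Lemma child_massE lam u : weight_bounded E lam ->
  (\esum_(v in children E u) (normc (lam v) ^+ 2)%:E = (child_mass lam u)%:E)%E.
Proof.
move=> bE; have [M _ /(_ u) le] := weight_boundedP tE bE.
rewrite /child_mass fineK// ge0_fin_numE; first exact: le_lt_trans le (ltry _).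
by apply: esum_ge0 => v _; rewrite lee_fin sqr_ge0.
Qed.

Lemma child_mass_ge0 lam u : 0 <= child_mass lam u.
Proof. by apply/fine_ge0/esum_ge0 => v _; rewrite lee_fin sqr_ge0. Qed.

(** The vertices are grouped by their parent [u]; [f u] is a common factor. *)
Lemma wshift_energy lam (f : V -> R[i]) : weight_bounded E lam ->
  (\esum_(v in [set: V]) (normc (lam v * f (parent E v)) ^+ 2)%:E =
   \esum_(u in [set: V]) (child_mass lam u * normc (f u) ^+ 2)%:E)%E.
Proof.
move=> bE; etransitivity.
  by apply: (esum_tree tE rE) => v; rewrite lee_fin sqr_ge0.
apply: eq_esum => u _; rewrite mulrC EFinM -child_massE//.
rewrite -esumZ_in; [|exact: sqr_ge0|move=> v; exact: sqr_ge0].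
by apply: eq_esum => v Euv; rewrite (parent_eq tE rE Euv) normcM exprMn mulrC.
Qed.

Lemma wshift_nrm2 lam (f : l2 R V) : weight_bounded E lam ->
  (nrm2 (wshift E lam f) =
   fine (\esum_(u in [set: V]) (child_mass lam u * normc (f u) ^+ 2)%:E))%E.
Proof.
move=> bE; rewrite -wshift_energy// /nrm2; congr fine.
by apply: eq_esum => v _; rewrite wshiftE.
Qed.

Lemma wshift_isometry lam : weight_bounded E lam ->
  (forall u, child_mass lam u = 1) -> isometry_op (wshift E lam).
Proof.
move=> bE m1; split; first exact: wshift_linear.
move=> f; rewrite !l2_normE /nrm wshift_nrm2// /nrm2; do 3! congr (_ _).
by apply: eq_esum => u _; rewrite m1 mul1r.
Qed.

(** The weight [w v] is the product of [lam] over the first [n] vertices of the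
chain of ancestors that starts at [v] itself. *)
Lemma iter_wshiftE lam n : weight_bounded E lam -> (forall v, lam v != 0) ->
  exists2 w : V -> R[i], forall v, w v != 0 &
  forall f v, iter n (wshift E lam) f v = w v * f (iter n (parent E) v).
Proof.
move=> bE lam0; elim: n => [|n [w w0 wE]].
  by exists (fun=> 1) => [v|f v]; rewrite ?oner_eq0 ?mul1r.
exists (fun v => lam v * w (parent E v)) => [v|f v]; first by rewrite mulf_neq0.
by rewrite iterS wshiftE// wE mulrA iterSr.
Qed.

Lemma iter_parent_surj n u : leafless E -> exists v, iter n (parent E) v = u.
Proof.
move=> lE; elim: n u => [|n IH] u; first by exists u.
have [v Euv] := lE u; have [w wv] := IH v; exists w.
by rewrite iterS wv; exact: parent_eq.
Qed.
End children_sums.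

(** * The factors of the polar decomposition *)

Section polar.
Context {R : realType} {V : choiceType}.
Variables (E : rel V) (lam : V -> R[i]).
Hypotheses (tE : is_directed_tree E) (rE : rootless E) (lE : leafless E).
Hypotheses (bE : weight_bounded E lam) (lam0 : forall v, lam v != 0).
Local Notation S := (wshift E lam).

Lemma child_mass_gt0 u : 0 < child_mass E lam u.
Proof.
have [v Euv] := lE u.
rewrite -lte_fin -child_massE//; apply: lt_le_trans (_ : (normc (lam v) ^+ 2)%:E <= _)%E.
  rewrite lte_fin exprn_gt0// lt_def.
  have -> : 0 <= normc (lam v) by case: (lam v) => ? ?; exact: sqrtr_ge0.
  by rewrite andbT; apply: contraNneq (lam0 v) => /eq0_normc ->.
apply: esum_ge; exists [set v].
  by split; [exact: finite_set1|move=> _ ->].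
by rewrite fsbig_set1.
Qed.

(** The amount by which [S] stretches the point mass at [u]. *)
Definition dilation u : R := Num.sqrt (child_mass E lam u).

Lemma dilation_gt0 u : 0 < dilation u.
Proof. by rewrite sqrtr_gt0 child_mass_gt0. Qed.

Lemma sqr_dilation u : dilation u ^+ 2 = child_mass E lam u.
Proof. by rewrite sqr_sqrtr// child_mass_ge0. Qed.

Lemma dilation_neq0 u : (dilation u)%:C != 0 :> R[i].
Proof. by rewrite fmorph_eq0 gt_eqF// dilation_gt0. Qed.

Lemma normc_real (r : R) : normc r%:C ^+ 2 = r ^+ 2.
Proof. by rewrite normc2/= expr0n addr0. Qed.

(** This is the modulus of [S]; by [diag_energy] the product is square summable
whenever [S f] is. *)
Definition diag : l2 R V -> l2 R V :=
  fun f => insubd (0 : l2 R V) (fun v => (dilation v)%:C * f v).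

Lemma diag_energy (f : l2 R V) :
  (\esum_(v in [set: V]) (normc ((dilation v)%:C * f v) ^+ 2)%:E =
   \esum_(u in [set: V]) (child_mass E lam u * normc (f u) ^+ 2)%:E)%E.
Proof.
by apply: eq_esum => v _; rewrite normcM exprMn normc_real sqr_dilation.
Qed.

Lemma diagE f v : diag f v = (dilation v)%:C * f v.
Proof.
rewrite /diag -l2_val insubdK//; apply/asboolP; rewrite /square_summable diag_energy.
by rewrite -wshift_energy//; exact: wshift_summable.
Qed.

Lemma diag_linear : linear diag.
Proof.
move=> c f g; apply: l2_ext => v.
by rewrite l2_addE l2_scaleE !diagE l2_addE l2_scaleE mulrDr mulrCA.
Qed.

(** [diag] and [S] stretch every vector equally; this is also how [diag] gets
its continuity. *)
Lemma diag_norm f : `|diag f| = `|S f|.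
Proof.
rewrite !l2_normE /nrm wshift_nrm2// -diag_energy /nrm2; do 3! congr (_ _).
by apply: eq_esum => v _; rewrite diagE.
Qed.

Lemma diag_bounded_op : bounded_op diag.
Proof.
have [lS cS] := wshift_bounded_op tE rE bE.
split; first exact: diag_linear.
exact: continuous_norm_eq diag_linear lS cS diag_norm.
Qed.

(** The weights of [S], rescaled to have unit l2 norm on each set of siblings. *)
Definition unit_weight v : R[i] := lam v / (dilation (parent E v))%:C.
Local Notation U := (wshift E unit_weight).

Lemma unit_weight_sum u :
  (\esum_(v in children E u) (normc (unit_weight v) ^+ 2)%:E = 1)%E.
Proof.
transitivity (\esum_(v in children E u)
    ((child_mass E lam u)^-1 * normc (lam v) ^+ 2)%:E)%E.
  apply: eq_esum => v Euv; rewrite /unit_weight (parent_eq tE rE Euv) normcM.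
  by rewrite exprMn -(fmorphV (real_complex R)) normc_real exprVn sqr_dilation mulrC.
rewrite esumZ_in; [|by rewrite invr_ge0 child_mass_ge0|by move=> v; exact: sqr_ge0].
by rewrite child_massE// -EFinM mulVf// gt_eqF// child_mass_gt0.
Qed.

Lemma unit_weight_bounded : weight_bounded E unit_weight.
Proof.
apply: le_lt_trans (ltry 1); apply: ge_ereal_sup => _ [u _ <-].
by rewrite unit_weight_sum.
Qed.

Lemma unit_shift_isometry : isometry_op U.
Proof.
apply: wshift_isometry => //; first exact: unit_weight_bounded.
by move=> u; rewrite /child_mass unit_weight_sum.
Qed.

Lemma wshift_factor f : S f = U (diag f).
Proof.
apply: l2_ext => v; rewrite wshiftE// wshiftE ?diagE//; last exact: unit_weight_bounded.
by rewrite /unit_weight mulrA divfK// dilation_neq0.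
Qed.

Lemma diag_selfadjoint f g : inner (diag f) g = inner f (diag g).
Proof.
apply: inner_termwise => v; rewrite !diagE.
by case: (f v) (g v) => [a b] [c d]; apply/eqP; rewrite eq_complex/=;
  apply/andP; split; apply/eqP; ring.
Qed.

Lemma diag_positive : positive_op diag.
Proof.
move=> f; have [sRe sIm] := rsummable_dot (l2P (diag f)) (l2P f).
have prodE v : diag f v * (f v)^* = (dilation v * normc (f v) ^+ 2)%:C.
  rewrite diagE normc2; case: (f v) => a b; apply/eqP.
  by rewrite eq_complex/=; apply/andP; split; apply/eqP; ring.
rewrite lecE/= -/(dot _ _); apply/andP; split.
  rewrite rsum_ge0//; last by move=> v; rewrite prodE.
  by apply/eqP; rewrite esum1// => v _; rewrite prodE.
rewrite rsum_ge0//; first by apply/fine_ge0/esum_ge0 => v _;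
  rewrite lee_fin prodE/= mulr_ge0 ?sqr_ge0// ltW// dilation_gt0.
by move=> v; rewrite prodE/= mulr_ge0 ?sqr_ge0// ltW// dilation_gt0.
Qed.

Lemma adjoint_wshiftK f : adjoint S (S f) = diag (diag f).
Proof.
apply: adjointE => g; rewrite !wshift_factor isometry_inner ?diag_selfadjoint//.
exact: unit_shift_isometry.
Qed.
End polar.

(** * Trees without branching *)

Section no_branching.
Context {V : choiceType} {E : rel V}.
Hypotheses (tE : is_directed_tree E) (rE : rootless E) (lE : leafless E).

Lemma iso_int_no_branching : digraph_iso E int_tree -> ~ exists u, branching E u.
Proof.
move=> [h [/bij_inj hI hE]] [u [v [w [/= Euv Euw]]]]; apply; apply: hI.
by move: Euv Euw; rewrite /children/= -!hE => /eqP -> /eqP ->.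
Qed.

Hypothesis nB : ~ exists u, branching E u.

Lemma child_uniq u v w : E u v -> E u w -> v = w.
Proof. by move=> Euv Euw; apply: contrapT => vw; apply: nB; exists u, v, w. Qed.

Definition child u : V := xget u (children E u).

Lemma childP u : E u (child u).
Proof. by have [v Euv] := lE u; exact: (xgetI (P := children E u) _ Euv). Qed.

Lemma child_eq u v : E u v -> child u = v.
Proof. exact/child_uniq/childP. Qed.

(** The vertex at signed distance [k] from [x0]; [Negz n] stands for
[- (n + 1)], hence the [n.+1] steps to the parent. *)
Definition level x0 (k : int) : V :=
  match k with Posz n => iter n child x0 | Negz n => iter n.+1 (parent E) x0 end.

Lemma level_succ x0 k : level x0 (k + 1) = child (level x0 k).
Proof.
case: k => [n|[|n]]; first by rewrite -PoszD addn1.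
  by rewrite /= (child_eq (parentP rE x0)).
have -> : Negz n.+1 + 1 = Negz n by lia.
by rewrite /level [in RHS]iterS (child_eq (parentP rE _)).
Qed.

Lemma level_pred x0 k : level x0 (k - 1) = parent E (level x0 k).
Proof.
rewrite -{2}(subrK 1 k) level_succ.
by rewrite (parent_eq tE rE (childP _)).
Qed.

(** The set of vertices that are reached is closed under both kinds of steps
along an undirected path. *)
Lemma level_surj x0 v : exists k, level x0 k = v.
Proof.
have [p] := dtree_connected tE x0 v; elim/last_ind: p v => [|p y IH] v /=.
  by move=> _ <-; exists 0.
rewrite rcons_path last_rcons => /andP[pp /orP e] <-.
have [k kE] := IH _ pp erefl; rewrite -kE in e; case: e => e.
  by exists (k + 1); rewrite level_succ (child_eq e).
by exists (k - 1); rewrite level_pred (parent_eq tE rE e).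
Qed.

Lemma level_path x0 k n :
  path E (level x0 k) [seq level x0 (k + i.+1%:Z) | i <- iota 0 n] /\
  last (level x0 k) [seq level x0 (k + i.+1%:Z) | i <- iota 0 n] = level x0 (k + n%:Z).
Proof.
elim: n => [|n [IHp IHl]]; first by rewrite addr0.
rewrite -addn1 iotaD map_cat/= cat_path last_cat IHp IHl/= add0n andbT; split.
  have -> : k + n.+1%:Z = k + n%:Z + 1 by lia.
  by rewrite level_succ; exact: childP.
by congr level; lia.
Qed.

(** Two equal vertices at different levels would close the path between them
into a directed cycle. *)
Lemma level_inj x0 : injective (level x0).
Proof.
suff lt j (n : nat) : level x0 j <> level x0 (j + n.+1%:Z).
  move=> j k jk; apply: contrapT => /eqP; rewrite neq_lt => /orP[] h.
    apply: (lt j `|k - j|.-1%N); rewrite jk; congr level; lia.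
  apply: (lt k `|j - k|.-1%N); rewrite -jk; congr level; lia.
move=> jn; have [pp ll] := level_path x0 j n.
have := dtree_acyclic tE
  (c := level x0 j :: [seq level x0 (j + i.+1%:Z) | i <- iota 0 n]).
rewrite /= rcons_path pp ll jn.
have -> : j + n.+1%:Z = j + n%:Z + 1 by lia.
by rewrite level_succ childP => /(_ isT).
Qed.

Lemma no_branching_iso_int : digraph_iso E int_tree.
Proof.
have [x0] := dtree_inhabited tE.
have [h hK] := choice (level_surj x0).
have Kh : cancel (level x0) h by move=> k; apply: (@level_inj x0); rewrite hK.
exists h; split; first by exists (level x0).
move=> u v; rewrite -{2}(hK u) -{2}(hK v) /int_tree; apply/eqP/idP => [->|].
  by rewrite level_succ; exact: childP.
by move=> /child_eq; rewrite -level_succ => /level_inj.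
Qed.
End no_branching.

(** * Centered weighted shifts *)

Section centered_shift.
Context {R : realType} {V : choiceType}.
Variables (E : rel V) (lam : V -> R[i]).
Hypotheses (tE : is_directed_tree E) (rE : rootless E) (lE : leafless E).
Hypotheses (bE : weight_bounded E lam) (lam0 : forall v, lam v != 0).
Local Notation S := (wshift E lam).
Local Notation U := (wshift E (unit_weight E lam)).
Local Notation D := (diag E lam).
Local Notation d := (dilation E lam).

Let iU : isometry_op U := unit_shift_isometry tE rE lE bE lam0.
Let SUD f : S f = U (D f) := wshift_factor tE rE lE bE lam0 f.
Let lS : linear S := wshift_linear tE rE bE.
Let lD : linear D := diag_linear tE rE bE.

Lemma diag_delta u : D (delta u) = (d u)%:C *: delta u.
Proof.
apply: l2_ext => v; rewrite diagE// l2_scaleE deltaE.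
by case: eqVneq => [->//|_]; rewrite !mulr0.
Qed.

Lemma wshift_polar : polar_decomposition S U D.
Proof.
have U0 x : U x = 0 <-> x = 0.
  split=> [/(congr1 (fun y => `|y|))|->]; last exact: linear0_eq iU.1.
  by rewrite iU.2 normr0 => /normr0_eq0.
split.
- exact: isometry_bounded_op.
- by move=> x _; exact: iU.2.
- split; [exact: diag_bounded_op|exact: diag_positive|].
  by move=> f /=; rewrite adjoint_wshiftK.
- exact: SUD.
- move=> x; rewrite SUD; split=> /U0; last first.
    move=> Dx; apply/U0; apply: l2_ext => v.
    have /eqP := congr1 (fun f : l2 R V => f v) Dx.
    rewrite /= diagE// mulf_eq0 (negbTE (dilation_neq0 tE lE bE lam0 v)) /= => /eqP.
    by [].
  by move=> ->; rewrite (linear0_eq lD) (linear0_eq iU.1).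
Qed.

(** A positive square root of [S* S] is determined on an eigenvector: the
vector [y = P x - c x] satisfies [P y = - c y], and positivity of [P] with
[c > 0] forces [y = 0]. *)
Lemma modulus_delta P u : is_modulus S P -> P (delta u) = (d u)%:C *: delta u.
Proof.
move=> [[lP _] P0 PP].
set c := (d u)%:C; set y := P (delta u) - c *: delta u.
have c0 : 0 < c by rewrite ltcR dilation_gt0.
have Py : P y = - c *: y.
  rewrite (zmod_morphism_linear lP) (scalable_linear lP) /=.
  have -> : P (P (delta u)) = c *: (c *: delta u).
    have /= -> := PP (delta u).
    by rewrite adjoint_wshiftK// !diag_delta (scalable_linear lD) /= diag_delta.
  by rewrite scaleNr /y scalerBr opprB.
have := P0 y; rewrite Py innerZl inner_norm mulNr oppr_ge0 pmulr_rle0//.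
move=> y0; apply/eqP; rewrite -subr_eq0 -normr_eq0 -sqrf_eq0 eq_le y0.
by rewrite exprn_ge0.
Qed.

(** By [modulus_delta], [W] and [U] agree on point masses, hence everywhere by
continuity. *)
Lemma polar_uniq W P : polar_decomposition S W P -> W = U.
Proof.
move=> [[lW cW] _ mP SWP _].
have agree : closed_subspace [set f | W f = U f].
  split.
  - by rewrite /= (linear0_eq lW) (linear0_eq iU.1).
  - by move=> a x y /= Wx Wy; rewrite lW iU.1 Wx Wy.
  - have -> : [set f | W f = U f] = (fun f => W f - U f) @^-1` [set 0].
      by apply/seteqP; split => f /= => [->|/eqP]; rewrite ?subrr// subr_eq0 => /eqP.
    have cWU : continuous (fun f => W f - U f).
      move=> f; exact: cvgB (cW f) (isometry_continuous iU (x := f)).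
    have /continuous_closedP := cWU; apply.
    exact/accessible_closed_set1/hausdorff_accessible/norm_hausdorff.
apply/funext => f; apply: (l2_dense agree) => u /=.
have := SWP (delta u); rewrite SUD /= (modulus_delta u mP) diag_delta.
rewrite (scalable_linear lW) (scalable_linear iU.1) /=.
by move/(scalerI (dilation_neq0 tE lE bE lam0 u)).
Qed.

Lemma type_I_wshiftP : centered S -> type_I_centered S <-> pure_isometry U.
Proof.
move=> cS; split=> [[_ [W [P [/polar_uniq -> //]]]]|pU].
by split=> //; exists U, D; split => //; exact: wshift_polar.
Qed.

Hypothesis cS : centered S.

(** Constancy of [d] on the n-th generation below [u], in the form of an
eigenvector equation. By induction on [n]: if it holds for the earlier
generations then [S*^n S^n delta_u] is a multiple of [delta_u], so
[h = S^n delta_u] is an eigenvector of [S^n S*^n]; commutation with [S* S] puts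
[D^2 h] in the range of [S^n], whose elements are a multiple of [h] on the
n-th generation. *)
Lemma diag_generation n u :
  exists2 e : R, e != 0 & D (iter n S (delta u)) = e%:C *: iter n S (delta u).
Proof.
elim/ltn_ind: n => n IH in u *; have [->|n0] := posnP n.
  by exists (d u); [rewrite gt_eqF ?dilation_gt0|exact: diag_delta].
set h := iter n S (delta u).
(* Peel off one factor [S* S = D^2] at a time; each acts as a scalar on the
   vector that it meets, by the induction hypothesis. *)
have back m (c : R[i]) : (m <= n)%N -> c != 0 -> exists2 c' : R[i], c' != 0 &
    iter m (adjoint S) (c *: iter m S (delta u)) = c' *: delta u.
  elim: m c => [|m IHm] c mn c0; first by exists c.
  have [e e0 De] := IH m mn u.
  have [|c' c'0 c'E] := IHm (c * (e%:C * e%:C)) (ltnW mn).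
    by rewrite !mulf_neq0// fmorph_eq0.
  exists c' => //; rewrite iterSr iterS -(scalable_linear lS) adjoint_wshiftK//.
  rewrite (scalable_linear lD) /= De scalerA (scalable_linear lD) /= De scalerA.
  by rewrite -mulrA c'E.
have [c c0] := back n 1 (leqnn _) (oner_neq0 _); rewrite scale1r -/h => hE.
pose y := iter n (adjoint S) (D (D h)).
have DDh : D (D (iter n S (c *: delta u))) = iter n S y.
  have A1 : power_products S (iter 1 (adjoint S) \o iter 1 S).
    by exists 1%N => //; right.
  have An : power_products S (iter n S \o iter n (adjoint S)).
    by exists n => //; left.
  have : adjoint S (S (iter n S (iter n (adjoint S) h))) =
      iter n S (iter n (adjoint S) (adjoint S (S h))) := cS A1 An h.
  by rewrite hE !(adjoint_wshiftK tE rE lE bE lam0).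
have [w w0 wE] := iter_wshiftE tE rE n bE lam0.
(* Compare the two sides of [DDh] at [v], where [w v] can be cancelled; the
   right-hand side depends on [v] through its n-th ancestor only. *)
have dE v : iter n (parent E) v = u -> ((d v) ^+ 2)%:C = y u / c.
  move=> vu; have : D (D (iter n S (c *: delta u))) v = iter n S y v.
    by rewrite DDh.
  rewrite !diagE// !wE vu l2_scaleE deltaE eqxx mulr1 => e.
  apply: (mulfI (w0 v)); apply: (mulIf c0).
  by rewrite -[RHS]mulrA divfK// -e rmorphXn /=; ring.
have [v0 v0u] := iter_parent_surj tE rE n u lE.
exists (d v0); first by rewrite gt_eqF ?dilation_gt0.
apply: l2_ext => v; rewrite l2_scaleE diagE// /h wE deltaE.
case: eqVneq => [vu|_]; last by rewrite !mulr0.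
have /complexI/eqP := etrans (dE v vu) (esym (dE v0 v0u)).
by rewrite eqrXn2 ?ltW ?dilation_gt0// => /eqP ->.
Qed.

Lemma iter_wshift_delta n u :
  exists2 c : R[i], c != 0 & iter n S (delta u) = c *: iter n U (delta u).
Proof.
elim: n => [|n [c c0 IH]]; first by exists 1; rewrite ?oner_eq0 ?scale1r.
have [e e0 De] := diag_generation n u.
exists (e%:C * c); first by rewrite mulf_neq0// fmorph_eq0.
by rewrite iterS SUD De IH scalerA (scalable_linear iU.1).
Qed.

(** Each side is a closed subspace, so it suffices to place the images of the
point masses, and these are proportional by [iter_wshift_delta]. *)
Lemma closure_range_wshift n : closure (range (iter n S)) = range (iter n U).
Proof.
have iUn := isometry_iter n iU.
rewrite eqEsubset; split.
  have rU := isometry_range_subspace iUn.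
  have [_ _ cl] := rU; rewrite [X in _ `<=` X](closure_id _).1//.
  apply: closureS => _ [f _ <-].
  have bSn := bounded_op_iter n (wshift_bounded_op tE rE bE).
  apply: (l2_dense (preimage_subspace bSn rU)) => u /=.
  have [c _ ->] := iter_wshift_delta n u.
  by exists (c *: delta u) => //; rewrite (scalable_linear iUn.1).
move=> _ [f _ <-].
have cl := closure_range_subspace (linear_iter n lS).
apply: (l2_dense (preimage_subspace (isometry_bounded_op iUn) cl)) => u /=.
apply: subset_closure; have [c c0 e] := iter_wshift_delta n u.
exists (c^-1 *: delta u) => //.
by rewrite (scalable_linear (linear_iter n lS)) /= e scalerA mulVf// scale1r.
Qed.

Lemma type_I_rangeP : type_I_centered S <->
  \bigcap_(n in [set n | (1 <= n)%N]) closure (range (iter n S)) = [set 0].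
Proof.
rewrite (type_I_wshiftP cS) (pure_isometryP iU).
by under eq_bigcapr do rewrite -closure_range_wshift.
Qed.

Lemma type_I_not_iso_int : type_I_centered S -> ~ digraph_iso E int_tree.
Proof.
move=> /type_I_rangeP capS /iso_int_no_branching nB.
(* The parent of [v] has no other child. *)
have wshift_delta v : S ((lam v)^-1 *: delta (parent E v)) = delta v.
  apply: l2_ext => w; rewrite wshiftE// l2_scaleE !deltaE.
  have [wv|wv] := eqVneq w v; first by rewrite wv eqxx mulr1 mulfV.
  case: eqVneq => [pw|_]; last by rewrite !mulr0.
  have Ew := parentP rE w; rewrite pw in Ew.
  by have /eqP := child_uniq nB Ew (parentP rE v); rewrite (negbTE wv).
have range_delta n v : range (iter n S) (delta v).
  elim: n v => [|n IH] v; first by exists (delta v).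
  have [f _ fE] := IH (parent E v); exists ((lam v)^-1 *: f) => //.
  by rewrite iterS (scalable_linear (linear_iter n lS)) /= fE.
have [x0] := dtree_inhabited tE.
suff : [set 0] (delta x0 : l2 R V) by move=> /eqP; rewrite (negbTE (delta_neq0 x0)).
by rewrite -capS => n _; exact: subset_closure.
Qed.
End centered_shift.

Theorem corollary19 (R : realType) (V : choiceType) (E : rel V) (lam : V -> R[i])
  (treeE : is_directed_tree E) (rootlessE : rootless E) (leaflessE : leafless E)
  (bounded_lam : weight_bounded E lam) (lam_neq0 : forall v, lam v != 0)
  (centeredS : centered (wshift E lam)) :
  [/\ type_I_centered (wshift E lam) <->
        \bigcap_(n in [set n | (1 <= n)%N])
           closure (range (iter n (wshift E lam))) = [set 0],
      type_I_centered (wshift E lam) -> ~ digraph_iso E int_tree &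
      ~ digraph_iso E int_tree <-> exists u, branching E u].
Proof.
split; [exact: type_I_rangeP|exact: type_I_not_iso_int|split].
  by move=> nZ; apply: contrapT => nB; apply: nZ; exact: no_branching_iso_int.
by move=> B /iso_int_no_branching; apply.
Qed.
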